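(* Let $G$ be a metrizable topological group, equipped with a compatible right-invariant metric $d$, and let $(K_n)_{n\in\mathbb{N}}$ be an increasing sequence of compact subgroups of $G$ such that (a) the union $\bigcup_{n\in\mathbb{N}}K_n$ is dense in $G$, and (b) the sequence of $mm$-spaces $(K_n,d|_{K_n\times K_n},\mu_n)_{n\in\mathbb{N}}$, where $\mu_n$ denotes the normalized Haar measure on $K_n$, concentrates to a fully supported, compact $mm$-space $(X,d_X,\mu_X)$. Then the topological space $X$ supports the structure of a $G$-flow with respect to which it admits a morphism to every $G$-flow; that is, there is a continuous action of $G$ on $X$ such that for every $G$-flow $Y$ there exists a continuous $G$-equivariant map $X\to Y$.
   Context: Topological groups are Hausdorff. A metric is compatible if it generates the topology. A $G$-flow is a non-empty compact Hausdorff space together with a continuous action of $G$ on it. An $mm$-space is a triple $(X,d,\mu)$ where $(X,d)$ is a separable complete metric space and $\mu$ is a Borel probability measure on $X$; it is compact if $(X,d)$ is compact, and fully supported if $\operatorname{spt}\mu=X$, where $\operatorname{spt}\mu$ is the set of all points each of whose open neighborhoods has positive measure. Let $\lambda$ be Lebesgue measure on $[0,1)$. A parametrization of $(X,d,\mu)$ is a Borel map $\varphi\colon[0,1)\to X$ with push-forward $\varphi_*(\lambda)=\mu$ (these always exist). For Borel functions $f,g\colon[0,1)\to\mathbb{R}$ let $\mathrm{me}_\lambda(f,g):=\inf\{\varepsilon>0 : \lambda(\{t : |f(t)-g(t)|>\varepsilon\})\le\varepsilon\}$, and let $(\mathrm{me}_\lambda)_{\mathrm{H}}$ be the associated Hausdorff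 distance between sets of Borel functions, i.e., $(\mathrm{me}_\lambda)_{\mathrm{H}}(A,B)=\inf\{\varepsilon>0 : $ every element of $B$ is at $\mathrm{me}_\lambda$-distance $<\varepsilon$ from some element of $A$, and vice versa$\}$. Let $\mathrm{Lip}_1(X)$ be the set of 1-Lipschitz functions $X\to\mathbb{R}$. Gromov's observable distance between $mm$-spaces is $$d_{\mathrm{conc}}(X,Y):=\inf\{(\mathrm{me}_\lambda)_{\mathrm{H}}(\mathrm{Lip}_1(X)\circ\varphi,\mathrm{Lip}_1(Y)\circ\psi) : \varphi \text{ a parametrization of } X,\ \psi\text{ a parametrization of } Y\}.$$ A sequence of $mm$-spaces $(X_n)$ concentrates to an $mm$-space $X$ if $d_{\mathrm{conc}}(X_n,X)\to0$. *)

(* Defs.v *)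
From HB Require Import structures.
From mathcomp Require Import all_boot all_order all_algebra.
From mathcomp Require Import all_classical all_reals all_analysis.
Import Order.TTheory GRing.Theory Num.Theory.
Import numFieldNormedType.Exports.

Set Implicit Arguments.
Unset Strict Implicit.
Unset Printing Implicit Defensive.

Local Open Scope classical_set_scope.
Local Open Scope ring_scope.

HB.mixin Record isTopologicalGroup G & Topological G & Group G := {
  mulg_continuous : continuous (fun xy : G * G => (xy.1 * xy.2)%g) ;
  invg_continuous : continuous (fun x : G => (x^-1)%g)
}.

#[short(type="topologicalGroupType")]
HB.structure Definition TopologicalGroup :=
  {G of Topological G & Group G & isTopologicalGroup G}.

(* The topology of a [metricType] is, by construction, the one generated by
   [mdist]: a [metricGroupType] is a topological group together with a
   compatible metric. *)
#[short(type="metricGroupType")]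
HB.structure Definition MetricGroup (R : numDomainType) :=
  {G of TopologicalGroup G & Metric R G}.

(* [Complete] requires a point; this is harmless below, as a space carrying a
   probability measure is nonempty. *)
#[short(type="completeMetricType")]
HB.structure Definition CompleteMetric (R : numDomainType) :=
  {T of Complete T & Metric R T}.

Section flows.
Context (G : topologicalGroupType).

Definition is_flow (Y : topologicalType) (act : G -> Y -> Y) : Prop :=
  [/\ [set: Y] !=set0, compact [set: Y], hausdorff_space Y,
      (forall y, act 1%g y = y) /\
      (forall g h y, act (g * h)%g y = act g (act h y)) &
      continuous (fun gy : G * Y => act gy.1 gy.2)].

Definition is_flow_morphism (X Y : topologicalType)
    (actX : G -> X -> X) (actY : G -> Y -> Y) (f : X -> Y) : Prop :=
  continuous f /\ forall g x, f (actX g x) = actY g (f x).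

End flows.

Definition borel (T : ptopologicalType) := g_sigma_algebraType (@open T).

Definition separable (T : topologicalType) : Prop :=
  exists2 D : set T, countable D & dense D.

Record mmSpace (R : realType) := MMSpace {
  mm_sort :> completeMetricType R ;
  mm_separable : separable mm_sort ;
  mm_measure : probability (borel mm_sort) R
}.

Section mm_spaces.
Context {R : realType}.
Implicit Types X Y : mmSpace R.

Definition spt X : set X :=
  [set x | forall U : set X, open U -> U x -> (0 < mm_measure X U)%E].
Arguments spt : clear implicits.

Definition fully_supported X : Prop := spt X = [set: X].

Definition Lip1 X : set (X -> R) :=
  [set f | forall x y, `|f x - f y| <= mdist x y].
Arguments Lip1 : clear implicits.

Definition I01 : set R := `[0, 1[.

(* Functions on [0, 1) are represented by functions on R of which only the
   values on [0, 1) matter. *)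
Definition parametrization X : set (R -> X) :=
  [set phi | measurable_fun I01 (phi : R -> borel X) /\
    forall A : set (borel X), measurable A ->
      lebesgue_measure (I01 `&` phi @^-1` A) = mm_measure X A].
Arguments parametrization : clear implicits.

(* The set is nonempty (it contains 1), so this real infimum is genuine. *)
Definition me (f g : R -> R) : R :=
  inf [set e : R | 0 < e /\
    (lebesgue_measure (I01 `&` [set t | (e < `|f t - g t|)%R])
       <= e%:E)%E].

Definition hausdorff_dist (T : Type) (d : T -> T -> R) (A B : set T) : \bar R :=
  ereal_inf [set e%:E | e in [set e : R | [/\ 0 < e,
    (forall b, B b -> exists2 a, A a & d b a < e) &
    (forall a, A a -> exists2 b, B b & d a b < e)]]].

Definition dconc X Y : \bar R :=
  ereal_inf [set z | exists (phi : R -> X) (psi : R -> Y),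
    [/\ parametrization X phi, parametrization Y psi &
        z = hausdorff_dist me [set f \o phi | f in Lip1 X]
                              [set f \o psi | f in Lip1 Y]]].

Definition concentrates (Xs : nat -> mmSpace R) X : Prop :=
  dconc (Xs n) X @[n --> \oo] --> 0%E.

End mm_spaces.

Arguments spt {R} X.
Arguments Lip1 {R} X.
Arguments parametrization {R} X.

Record compactSubgroup (G : topologicalGroupType) := CompactSubgroup {
  cs_set : set G ;
  cs_compact : compact cs_set ;
  cs_group : group_closed (mem cs_set)
}.

(* The subgroup as a type of its own, with the subspace topology and (for a
   metric group) the restricted metric. *)
Definition cs_type (G : topologicalGroupType) (K : compactSubgroup G) : Type :=
  set_type (cs_set K).
Coercion cs_type : compactSubgroup >-> Sortclass.

Section subgroup_group.
Context {G : topologicalGroupType} (K : compactSubgroup G).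
Local Notation T := (cs_type K).

HB.instance Definition _ := Topological.copy T (set_type (cs_set K)).

Let one : T := exist _ 1%g (proj1 (cs_group K)).

Let mulP (x y : T) : (val x * val y)%g \in cs_set K.
Proof. exact: (group_closedM (cs_group K) (valP x) (valP y)). Qed.
Let mul (x y : T) : T := exist _ (val x * val y)%g (mulP x y).

Let invP (x : T) : (val x)^-1%g \in cs_set K.
Proof. exact: (group_closedV (cs_group K) (valP x)). Qed.
Let inv (x : T) : T := exist _ (val x)^-1%g (invP x).

Let mulA : associative mul.
Proof. by move=> x y z; apply: val_inj; rewrite /= mulgA. Qed.
Let mul1 : left_id one mul.
Proof. by move=> x; apply: val_inj; rewrite /= mul1g. Qed.
Let mulr1 : right_id one mul.
Proof. by move=> x; apply: val_inj; rewrite /= mulg1. Qed.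
Let mulV : left_inverse one inv mul.
Proof. by move=> x; apply: val_inj; rewrite /= mulVg. Qed.
Let mulVr : right_inverse one inv mul.
Proof. by move=> x; apply: val_inj; rewrite /= mulgV. Qed.

HB.instance Definition _ := isPointed.Build T one.
HB.instance Definition _ := isGroup.Build T mulA mul1 mulr1 mulV mulVr.

Lemma cs_type_compact : compact [set: T].
Proof.
move=> F FF _; have FK : (val @ F) (cs_set K).
  apply: (@filterS _ F _ setT); last exact: filterT.
  by move=> x _; exact: set_mem (valP x).
have [p [Kp clp]] := @cs_compact _ K (val @ F) _ FK.
exists (exist _ p (mem_set Kp)); split=> // A B FA [_ [[U oU <-] /= Up UB]].
have FvA : (val @ F) [set val x | x in A].
  by apply: (@filterS _ F _ A) => // x Ax; exists x.
have [_ [[x Ax <-] Ux]] := clp _ U FvA (open_nbhs_nbhs (conj oU Up)).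
by exists x; split=> //; exact: UB.
Qed.

End subgroup_group.

Section subgroup_metric.
Context {R : realType} {G : metricGroupType R} (K : compactSubgroup G).
Local Notation T := (cs_type K).

HB.instance Definition _ := PseudoMetric.copy T (set_type (cs_set K)).

Let dist (x y : T) : R := mdist (val x) (val y).
Let dist_ge0 x y : 0 <= dist x y. Proof. exact: mdist_ge0. Qed.
Let dist_positivity x y : dist x y = 0 -> x = y.
Proof. by move=> /mdist_positivity; exact: val_inj. Qed.
Let dist_ball (x : T) (e : R) : ball x e = [set y | dist x y < e].
Proof.
by apply/funext => y; rewrite -[LHS]/(ball (val x) e (val y)) ballEmdist.
Qed.

HB.instance Definition _ :=
  PseudoMetric_isMetric.Build R T dist_ge0 dist_positivity dist_ball.

Let complete (F : set_system T) : ProperFilter F -> cauchy F -> cvg F.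
Proof.
move=> FF cF; apply: (compact_cauchy_cvg FF cF filterT).
exact: cs_type_compact.
Qed.

HB.instance Definition _ := Uniform_isComplete.Build T complete.

Lemma cs_type_separable : separable T.
Proof.
have [B cB [oB bB]] := @compact_second_countable R T (@cs_type_compact G K).
exists (get @` B); first exact: sub_countable (card_image_le _ _) cB.
move=> O [x Ox] oO.
have [U [BU Ux] UO] := bB x O (open_nbhs_nbhs (conj oO Ox)).
by exists (get U); split; [apply: UO; exact: (getI Ux)|exists U].
Qed.

End subgroup_metric.

Definition subgroup_mmSpace (R : realType) (G : metricGroupType R)
    (K : compactSubgroup G) (mu : probability (borel K) R) : mmSpace R :=
  @MMSpace R K (cs_type_separable K) mu.

(* Borel probability measures on compact metrizable spaces are automatically
   regular, so left invariance characterizes the normalized Haar measure. *)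
Definition is_normalized_haar (R : realType) (G : metricGroupType R)
    (K : compactSubgroup G) (mu : probability (borel K) R) : Prop :=
  forall (g : K) (A : set K), measurable (A : set (borel K)) ->
    mu [set (g * x)%g | x in A] = mu A.

(* Main.v *)
(** The flow is built from limits of functions along the parametrizations.
    Let [phi n] and [psi n] parametrize [K n] and [X] on [0, 1), almost
    optimally for the observable distance, and fix a non-principal ultrafilter
    on the indices [n].  Convergence in measure along it is a filter [GG] on
    pairs [(n, t)].  Concentration says that a sequence of 1-Lipschitz
    functions [H n] on [G] satisfies [H n (phi n t) - f (psi n t) --> 0] along
    [GG] for some 1-Lipschitz [f] on [X], and that every such [f] arises.

    Hence for a bounded equi-uniformly continuous sequence [H] and [x : X], the
    values [H n (phi n t)] converge along the filter "[GG] and [psi n t --> x]",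
    to a limit [flim H x] that is continuous in [x]; full support makes this
    filter proper.  Invariance of Haar measure and density of the union of the
    [K n] show that sets that are [GG]-large remain so, up to a small
    enlargement, after left translation by any [g : G].  Together with
    compactness of [X] this yields a point [g x] such that
    [flim (H (g * _)) x = flim H (g x)] for all [H].  By right invariance of the
    metric, this defines a continuous action.

    For a [G]-flow [Y] with base point [y0] and continuous [h : Y -> R], the
    function [h (k * y0)] of [k] is uniformly continuous; the morphism sends [x]
    to the point [f x] with [h (f x) = flim (h (_ * y0)) x] for all [h]. *)

Require Import Defs.
From HB Require Import structures.
From mathcomp Require Import all_boot all_order all_algebra.
From mathcomp Require Import all_classical all_reals all_analysis.
From mathcomp Require Import finmap ring lra measurable_realfun.
Import Order.TTheory GRing.Theory Num.Theory.
Import numFieldNormedType.Exports.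

Local Open Scope classical_set_scope.
Local Open Scope ring_scope.

Set Implicit Arguments.
Unset Strict Implicit.
Unset Printing Implicit Defensive.

(** * Lipschitz approximation *)

Section clamp.
Context {R : realDomainType}.
Implicit Types lo hi a b : R.

Definition clamp lo hi a := Num.max lo (Num.min a hi).

Lemma clamp_ge lo hi a : lo <= clamp lo hi a.
Proof. by rewrite le_max lexx. Qed.

Lemma clamp_le lo hi a : lo <= hi -> clamp lo hi a <= hi.
Proof. by move=> lohi; rewrite ge_max lohi ge_min lexx orbT. Qed.

Lemma clamp_id lo hi a : lo <= a <= hi -> clamp lo hi a = a.
Proof. by move=> /andP[? ?]; rewrite /clamp min_l// max_r. Qed.

Lemma clamp_lip lo hi a b : lo <= hi -> `|clamp lo hi a - clamp lo hi b| <= `|a - b|.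
Proof.
move=> lohi; suff h u v : clamp lo hi u - clamp lo hi v <= `|u - v|.
  by rewrite ler_norml lerNl opprB distrC h distrC h.
have := ler_norm (u - v); have := normr_ge0 (u - v); rewrite /clamp.
case: (leP u hi) => ?; case: (leP v hi) => ?; rewrite ?(max_idPr lohi).
- by case: (leP lo u) => ?; case: (leP lo v) => ?; lra.
- by case: (leP lo u) => ?; lra.
- by case: (leP lo v) => ?; lra.
- by lra.
Qed.

End clamp.

Section inf_convolution.
Context {R : realType} {T : metricType R} {A : Type} (j : A -> T).

(** The McShane extension of [u] along [j]. It serves twice: with [j] the identity to regularize a
    function, with [j] the inclusion of a subgroup to extend one. *)
Definition inf_conv (L : R) (u : A -> R) (x : T) : R :=
  inf [set u a + L * mdist x (j a) | a in [set: A]].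

Lemma inf_conv_lip (L : R) (u : A -> R) : 0 <= L -> [set: A] !=set0 ->
  (forall x, has_lbound [set u a + L * mdist x (j a) | a in [set: A]]) ->
  forall x y, `|inf_conv L u x - inf_conv L u y| <= L * mdist x y.
Proof.
move=> L0 [a0 _] lb.
suff H x y : inf_conv L u x - inf_conv L u y <= L * mdist x y.
  by move=> x y; rewrite ler_norml lerNl opprB H metric_sym H.
rewrite lerBlDr -lerBlDl; apply: lb_le_inf; first by exists (u a0 + L * mdist y (j a0)), a0.
move=> _ [a _ <-]; rewrite lerBlDl.
apply: (@le_trans _ _ (u a + L * mdist x (j a))).
  by apply: ge_inf; [exact: lb|exists a].
by rewrite addrCA lerD2l -mulrDr ler_wpM2l// metric_triangle.
Qed.

Lemma inf_conv_id (L : R) (u : A -> R) : 0 <= L ->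
  (forall a b, `|u a - u b| <= L * mdist (j a) (j b)) ->
  (forall x, has_lbound [set u a + L * mdist x (j a) | a in [set: A]]) /\
  forall a, inf_conv L u (j a) = u a.
Proof.
move=> L0 uL.
have ule a b : u a <= u b + L * mdist (j a) (j b).
  by rewrite -lerBlDl (le_trans (ler_norm _)).
have lb x : has_lbound [set u a + L * mdist x (j a) | a in [set: A]].
  have [[a0 _]|A0] := pselect ([set: A] !=set0); last first.
    by exists 0 => ? [a _ _]; exfalso; apply: A0; exists a.
  exists (u a0 - L * mdist x (j a0)) => _ [a _ <-].
  rewrite lerBlDr -addrA -mulrDr (le_trans (ule a0 a))// lerD2l ler_wpM2l//.
  by rewrite addrC (le_trans (metric_triangle _ x _))// (metric_sym (j a0)).
split=> // a; apply/eqP; rewrite eq_le; apply/andP; split.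
  by apply: ge_inf; [exact: lb|exists a => //; rewrite mdistxx mulr0 addr0].
apply: lb_le_inf; first by exists (u a + L * mdist (j a) (j a)), a.
by move=> _ [b _ <-]; exact: ule.
Qed.

End inf_convolution.

(** Take the infimal convolution with [L = 2 * M / d]: points closer than [d] lower the value by at
    most [e], and for the others the penalty [2 * M] outweighs the oscillation of [u]. Since [L]
    does not depend on [u], it serves a whole family at once. *)
Lemma unif_cont_lip_approx {R : realType} {T : metricType R} (M e : R) (d : R) :
  0 < d -> 0 < M -> 0 < e -> exists2 L : R, 0 < L &
  forall u : T -> R, (forall x, `|u x| <= M) ->
    (forall x y, mdist x y < d -> `|u x - u y| < e) ->
    exists v : T -> R, [/\ forall x y, `|v x - v y| <= L * mdist x y,
      (forall x, `|v x| <= M + e) & forall x, `|u x - v x| <= e].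
Proof.
move=> d0 M0 e0; have L0 : 0 < 2 * M / d by rewrite divr_gt0// mulr_gt0.
exists (2 * M / d) => // u uM ud.
have lb (x : T) : has_lbound [set u a + 2 * M / d * mdist x (id a) | a in [set: T]].
  exists (- M) => _ [a _ <-]; apply: ler_wpDr; first by rewrite mulr_ge0 ?mdist_ge0// ltW.
  by have := uM a; rewrite ler_norml => /andP[].
have vu x : inf_conv id (2 * M / d) u x <= u x.
  by apply: ge_inf; [exact: lb|exists x => //; rewrite mdistxx mulr0 addr0].
have uv x : u x - e <= inf_conv id (2 * M / d) u x.
  apply: lb_le_inf; first by exists (u x + 2 * M / d * mdist x x), x.
  move=> _ [a _ <-]; have [xa|xa] := ltP (mdist x a) d.
    have Lxa : 0 <= 2 * M / d * mdist x a by rewrite mulr_ge0 ?mdist_ge0// ltW.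
    by have := ud _ _ xa; rewrite ltr_norml => /andP[_]; lra.
  apply: (@le_trans _ _ (u a + 2 * M)).
    have := uM a; have := uM x; rewrite !ler_norml => /andP[_ xM] /andP[aM _].
    by lra.
  by rewrite lerD2l mulrAC ler_pdivlMr// ler_wpM2l// mulr_ge0// ltW.
exists (inf_conv id (2 * M / d) u); split.
- by move=> x; apply: inf_conv_lip => //; [exact: ltW|exists x].
- move=> x; have := uM x; have := vu x; have := uv x; rewrite !ler_norml => h1 h2 /andP[h3 h4].
  by apply/andP; split; lra.
- move=> x; have := vu x; have := uv x; rewrite ler_norml => h1 h2.
  by apply/andP; split; lra.
Qed.

Lemma nbhs_mdist_ex {R : numDomainType} {T : metricType R} (x : T) (S : set T) :
  nbhs x S <-> exists2 d : R, 0 < d & forall y, mdist x y < d -> S y.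
Proof.
rewrite -metricType_numDomainType.filter_from_mdist_nbhs.
by split=> -[d d0 dS]; exists d.
Qed.

Lemma lip1_continuous {R : realFieldType} {T : metricType R} (f : T -> R) :
  (forall x y, `|f x - f y| <= mdist x y) -> continuous f.
Proof.
move=> fL x; apply/cvgrPdist_lt => e e0; apply/nbhs_mdist_ex; exists e => // y.
exact/le_lt_trans/fL.
Qed.

(** * Filters over the fibres of a map *)

Section fibre_filter.
Context {X : topologicalType} {P : Type} (GG : set_system P) (psi : P -> X).

Definition fibre_filter (x : X) : set_system P :=
  [set S | exists2 U, nbhs x U & GG [set p | U (psi p) -> S p]].

Lemma fibre_filter_filter {FG : Filter GG} x : Filter (fibre_filter x).
Proof.
split.
- by exists setT; [exact: filterT|apply: filterS filterT].
- move=> S S' [U xU US] [U' xU' US']; exists (U `&` U'); first exact: filterI.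
  by apply: filterS2 US US' => p /= pU pU' [/pU ? /pU' ?]; split.
- by move=> S S' SS' [U xU US]; exists U => //; apply: filterS US => p /= h /h /SS'.
Qed.

Lemma fibre_filter_proper {FG : Filter GG} x :
  (forall U, nbhs x U -> ~ GG [set p | ~ U (psi p)]) ->
  ProperFilter (fibre_filter x).
Proof.
move=> GGU; apply: Build_ProperFilter_ex; last exact: fibre_filter_filter.
move=> S [U xU US]; apply: contrapT => S0; apply: (GGU _ xU).
by apply: filterS US => p pU /pU Sp; apply: S0; exists p.
Qed.

Lemma sub_fibre_filter {FG : Filter GG} x : GG `<=` fibre_filter x.
Proof. by move=> S GS; exists setT; [exact: filterT|apply: filterS GS => p Sp _]. Qed.

(** A neighborhood of [x] is one of each of its interior points. This is the source of the
    continuity of [flim]. *)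
Lemma near_fibre_filter {FG : Filter GG} x S :
  fibre_filter x S -> \forall y \near x, fibre_filter y S.
Proof.
move=> [U xU US]; apply: filterS (nbhs_interior xU) => y yU.
by exists U.
Qed.

End fibre_filter.

(** * Equi-uniformly continuous families on a metric group *)

Section equi_uniformly_continuous.
Context {R : realType} {I : Type}.

Definition equi_ucb {T : metricType R} (H : I -> T -> R) : Prop :=
  (exists M : R, forall i k, `|H i k| <= M) /\
  forall e : R, 0 < e -> exists2 d : R, 0 < d &
    forall i k k', mdist k k' < d -> `|H i k - H i k'| < e.

Lemma equi_ucb_continuous (T : metricType R) (H : I -> T -> R) i :
  equi_ucb H -> continuous (H i).
Proof.
move=> [_ Huc] x; apply/cvgrPdist_lt => e /Huc[d d0 Hd].
by apply/nbhs_mdist_ex; exists d => // y; exact: Hd.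
Qed.

Lemma equi_ucb_lip (T : metricType R) (H : I -> T -> R) (M : R) :
  (forall i k, `|H i k| <= M) ->
  (forall i k k', `|H i k - H i k'| <= mdist k k') -> equi_ucb H.
Proof.
by move=> HM HL; split; [exists M|move=> e e0; exists e => // i k k' /le_lt_trans; exact].
Qed.

End equi_uniformly_continuous.

Section metric_group.
Context {R : realType} {G : metricGroupType R}.
Context (d_right_invariant :
  forall g x y : G, mdist (x * g)%g (y * g)%g = mdist x y).

Lemma mdist_mulV (x y : G) : mdist x y = mdist (x * y^-1)%g 1%g.
Proof. by rewrite -(d_right_invariant y^-1%g) mulgV. Qed.

Lemma continuous_mulg (T : topologicalType) (f g : T -> G) :
  continuous f -> continuous g -> continuous (fun t => f t * g t)%g.
Proof.
move=> cf cg t.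
apply: (@cvg_comp _ _ _ (fun t => (f t, g t)) (fun xy : G * G => xy.1 * xy.2)%g).
  exact: (@cvg_pair _ _ _ (nbhs t) (nbhs (f t)) (nbhs (g t)) _ _ _ f g (cf t) (cg t)).
exact: (mulg_continuous (f t, g t)).
Qed.

(** By right invariance [mdist k k'] is the distance from [k * k'^-1] to 1. Left translation by [g]
    conjugates this quotient by [g], and conjugation is continuous at 1. *)
Lemma left_translation_uc (g : G) (e : R) : 0 < e -> exists2 d : R, 0 < d &
  forall k k' : G, mdist k k' < d -> mdist (g * k)%g (g * k')%g < e.
Proof.
move=> e0.
have cj : continuous (fun u : G => g * u * g^-1)%g.
  apply: continuous_mulg; last exact: cst_continuous.
  by apply: continuous_mulg; [exact: cst_continuous|move=> ?; exact: cvg_id].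
have cj1 : (g * u * g^-1)%g @[u --> 1%g] --> (g * 1 * g^-1)%g := cj 1%g.
rewrite mulg1 mulgV in cj1.
have [d d0 dP] := (nbhs_mdist_ex _ _).1 (metricType_numDomainType.cvgr_dist_lt cj1 e0).
exists d => // k k'.
rewrite mdist_mulV metric_sym => /dP.
by rewrite (mdist_mulV (g * k)%g) invgM -!mulgA metric_sym.
Qed.

Lemma equi_ucb_translate {I : Type} (g : G) (H : I -> G -> R) :
  equi_ucb H -> equi_ucb (fun i k => H i (g * k)%g).
Proof.
move=> [[M HM] Huc]; split; first by exists M.
move=> e /Huc[d /(left_translation_uc g)[d' d'0 gd] Hd].
by exists d' => // i k k' /gd; exact: Hd.
Qed.

End metric_group.

(** * Continuous functions on compact Hausdorff spaces *)

Section compact_hausdorff_functions.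
Context {R : realType} {Y : topologicalType}.
Context (Y_compact : compact [set: Y]) (Y_hausdorff : hausdorff_space Y).

Lemma compact_hausdorff_bump (a : Y) (U : set Y) : nbhs a U ->
  exists2 h : Y -> R, continuous h & h a = 0 /\ forall y, ~ U y -> h y = 1.
Proof.
rewrite nbhsE => -[V [oV Va] VU].
have Yreg : completely_regular_space Y.
  apply: (@normal_completely_regular R); first exact: compact_normal.
  exact: hausdorff_accessible.
have [|h [ch _ h0 h1]] := (@uniform_separatorP _ R _ _).1 (Yreg a _ (open_closedC oV) _).
  by apply.
exists h => //; split; first by apply: h0; exists a.
by move=> y Uy; apply: h1; exists y => // /VU.
Qed.

Lemma continuous_functions_separate (a b : Y) :
  (forall h : Y -> R, continuous h -> h a = h b) -> a = b.
Proof.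
move=> hab; apply: Y_hausdorff => U V aU bV; apply: contrapT => UV0.
have [h ch [ha h1]] := compact_hausdorff_bump aU.
have Ub : U b.
  apply: contrapT => Ub; have := hab _ ch; rewrite ha h1// => /eqP.
  by rewrite eq_sym oner_eq0.
by apply: UV0; exists b; split=> //; exact: nbhs_singleton.
Qed.

Lemma continuous_functions_initial (T : topologicalType) (f : T -> Y) :
  (forall h : Y -> R, continuous h -> continuous (h \o f)) -> continuous f.
Proof.
move=> hf x U xU; have [h ch [hx h1]] := compact_hausdorff_bump xU.
have /cvgrPdist_lt/(_ _ ltr01) := hf _ ch x.
apply: filterS => t /=; rewrite hx sub0r normrN => ht.
by apply: contrapT => /h1 h1t; move: ht; rewrite h1t normr1 ltxx.
Qed.

End compact_hausdorff_functions.

(** Compactness of [Y] makes elements near 1 change [h] by less than [e] uniformly on [Y]. Apply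
    this to [k * k'^-1] at the point [actY k' y0]. *)
Lemma orbit_equi_ucb {R : realType} {G : metricGroupType R} {I : Type}
    (d_right_invariant :
      forall g x y : G, mdist (x * g)%g (y * g)%g = mdist x y)
    (Y : topologicalType) (actY : G -> Y -> Y) (y0 : Y) (h : Y -> R) :
  is_flow actY -> continuous h ->
  equi_ucb (fun (_ : I) k => h (actY k y0)).
Proof.
move=> [_ cY _ [act1 actM] cact] ch; split.
  have [M [_ HM]] : bounded_set (h @` [set: Y]).
    by apply/compact_bounded/continuous_compact => //; exact: continuous_subspaceT.
  by exists (M + 1) => _ k; apply: (HM (M + 1)); [rewrite ltrDl|exists (actY k y0)].
move=> e e0; have e20 : 0 < e / 2 by rewrite divr_gt0.
have act_near : \forall g \near (1%g : G),
    [set: Y] `<=` (fun y => `|h (actY g y) - h y| < e).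
  apply: ((compact_near_coveringP _).1 cY) => y _.
  have ha : continuous (fun gy : G * Y => h (actY gy.1 gy.2)).
    by move=> gy; apply: (continuous_comp (cact gy)); exact: ch.
  have /cvgrPdist_lt/(_ _ e20)[[A B] /= [A1 By] AB] := ha (1%g, y).
  have /cvgrPdist_lt/(_ _ e20) hy := ch y.
  exists (B `&` [set y' | `|h y - h y'| < e / 2], A).
    by split=> //; exact: filterI.
  move=> [y' g] /= [[By' hy'] Ag]; have := AB (g, y') (conj Ag By').
  move: hy'; rewrite /= act1 !ltr_norml => /andP[? ?] /andP[? ?].
  by apply/andP; split; lra.
have [d d0 dP] := (nbhs_mdist_ex _ _).1 act_near; exists d => // _ k k'.
rewrite (mdist_mulV d_right_invariant) metric_sym => /dP/(_ (actY k' y0) Logic.I).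
by rewrite -actM mulgVK.
Qed.

(** * Limits of functions and the limit action *)

Lemma ltr_norm_scale {R : realFieldType} (L a b c : R) : 0 < L ->
  `|a / L - b| < c / L -> `|a - L * b| < c.
Proof.
move=> L0; rewrite -(ltr_pM2r L0) divfK ?gt_eqF// -[X in `|_| * X](gtr0_norm L0).
by rewrite -normrM mulrBl divfK ?gt_eqF// (mulrC b).
Qed.

Section concentration_limit.
Context {R : realType} {G : metricGroupType R} {X : completeMetricType R} {P I : Type}.
Context (GG : set_system P) {FG : Filter GG}.
Context (iota : P -> I) (phi : P -> G) (psi : P -> X).
Context (psi_full : forall (x : X) U, nbhs x U -> ~ GG [set p | ~ U (psi p)]).

Definition close_along (H : I -> G -> R) (f : X -> R) : Prop :=
  forall e : R, 0 < e -> GG [set p | `|H (iota p) (phi p) - f (psi p)| < e].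

Context (descend : forall H : I -> G -> R,
  (exists M : R, forall i k, `|H i k| <= M) ->
  (forall i k k', `|H i k - H i k'| <= mdist k k') ->
  exists2 f : X -> R, (forall x y, `|f x - f y| <= mdist x y) & close_along H f).

Local Notation F := (fibre_filter GG psi).
Local Notation ev H := (fun p => H (iota p) (phi p)).

#[local] Instance fibre_proper x : ProperFilter (F x).
Proof. by apply: fibre_filter_proper => U; exact: psi_full. Qed.

(** Approximate all [H i] by [L]-Lipschitz functions with a common [L], rescale by [L], and descend
    to some [f]. Near [x] the values of [L * f] are close to [L * f x], which is the constant
    [c]. *)
Lemma equi_ucb_fibre_osc (H : I -> G -> R) (x : X) (e : R) : equi_ucb H -> 0 < e ->
  exists c, F x [set p | `|ev H p - c| < e].
Proof.
move=> [[M HM] Huc] e0; have e40 : 0 < e / 4 by rewrite divr_gt0.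
have [d d0 Hd] := Huc _ e40.
have M1 : 0 < `|M| + 1 by rewrite ltr_wpDl.
have [L L0 approx] := @unif_cont_lip_approx R G _ _ _ d0 M1 e40.
have /(_ _)/cid-/all_sig[v vP] i : exists v : G -> R,
    [/\ forall k k', `|v k - v k'| <= L * mdist k k',
      (forall k, `|v k| <= `|M| + 1 + e / 4) & forall k, `|H i k - v k| <= e / 4].
  apply: approx => [k|k k']; last exact: Hd.
  by rewrite (le_trans (HM i k))// (le_trans (ler_norm _))// lerDl.
have [f fL vf] : exists2 f : X -> R, (forall x y, `|f x - f y| <= mdist x y) &
    close_along (fun i k => v i k / L) f.
  apply: descend.
    exists ((`|M| + 1 + e / 4) / L) => i k; have [_ vM _] := vP i.
    by rewrite normrM (gtr0_norm (x := L^-1)) ?invr_gt0// ler_pM2r ?invr_gt0.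
  move=> i k k'; have [vL _ _] := vP i.
  by rewrite -mulrBl normrM (gtr0_norm (x := L^-1)) ?invr_gt0// ler_pdivrMr// mulrC.
have eL0 : 0 < e / 4 / L by rewrite divr_gt0.
exists (L * f x), [set y | mdist x y < e / 4 / L].
  by apply/nbhs_mdist_ex; exists (e / 4 / L).
apply: filterS (vf _ eL0) => p /= vfp xp.
have [_ _ /(_ (phi p)) Hv] := vP (iota p).
have fx : `|f (psi p) - f x| < e / 4 / L.
  by rewrite (le_lt_trans (fL _ _))// metric_sym.
move/(ltr_norm_scale L0): vfp => vfp.
rewrite -(mulKf (lt0r_neq0 L0) (f (psi p))) [L^-1 * _]mulrC in fx.
move/(ltr_norm_scale L0): fx => fx.
move: fx vfp Hv; rewrite !ltr_norml ler_norml => /andP[? ?] /andP[? ?] /andP[? ?].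
by apply/andP; split; lra.
Qed.

(** [lim] is meaningful only where the limit exists; [cvg_flim] ensures this for [equi_ucb]
    families. *)
Definition flim (H : I -> G -> R) (x : X) : R := lim (ev H @ F x).

Lemma cvg_flim H x : equi_ucb H -> ev H @ F x --> flim H x.
Proof.
move=> Huc; apply: cauchy_cvg; apply: cauchy_exP => e e0.
have [c cP] := equi_ucb_fibre_osc x Huc e0; exists c.
by apply: filterS cP => p /=; rewrite distrC.
Qed.

Lemma flim_near H x (e : R) : equi_ucb H -> 0 < e ->
  F x [set p | `|ev H p - flim H x| < e].
Proof.
move=> Huc e0; have /cvgrPdist_lt/(_ _ e0) := cvg_flim (x := x) Huc.
by apply: filterS => p; rewrite distrC.
Qed.

Lemma flim_unique H x (c : R) : equi_ucb H ->
  (forall e : R, 0 < e -> F x [set p | `|ev H p - c| < e]) -> flim H x = c.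
Proof.
move=> Huc Hc; apply: cvg_lim => //; apply/cvgrPdist_lt => e /Hc.
by apply: filterS => p /=; rewrite distrC.
Qed.

Lemma flim_continuous H : equi_ucb H -> continuous (flim H).
Proof.
move=> Huc x; apply/cvgrPdist_lt => e e0; have e20 : 0 < e / 2 by rewrite divr_gt0.
have nx := near_fibre_filter (flim_near x Huc e20); near=> y.
have yx : F y [set p | `|ev H p - flim H x| < e / 2] by near: y; exact: nx.
have := filter_ex (filterI yx (flim_near y Huc e20)) => -[p [/=]].
rewrite !ltr_norml => /andP[? ?] /andP[? ?].
by apply/andP; split; lra.
Unshelve. all: by end_near.
Qed.

Lemma flim_close H f x : equi_ucb H -> continuous f -> close_along H f -> flim H x = f x.
Proof.
move=> Huc cf Hf; apply: flim_unique => // e e0; have e20 : 0 < e / 2 by rewrite divr_gt0.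
have /cvgrPdist_lt/(_ _ e20) fx := cf x.
exists (fun y => `|f x - f y| < e / 2) => //.
apply: filterS (Hf _ e20) => p /=; rewrite !ltr_norml => /andP[? ?] /andP[? ?].
by apply/andP; split; lra.
Qed.



(** * Construction of the limit action and its universal property *)

Context (d_right_invariant :
  forall g x y : G, mdist (x * g)%g (y * g)%g = mdist x y).
Context (X_compact : compact [set: X]).
Context (lift : forall f : X -> R, (forall x y, `|f x - f y| <= mdist x y) ->
  exists2 H : I -> G -> R,
    (forall i k k', `|H i k - H i k'| <= mdist k k') & close_along H f).
Context (translate : forall S : I -> set G, (forall i, open (S i)) ->
  GG [set p | S (iota p) (phi p)] -> forall g (eta : R), 0 < eta ->
  GG [set p | exists2 k, S (iota p) k & mdist (g * phi p)%g k < eta]).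

(* Truncated so that its lifts to [G] can be taken bounded. *)
Definition tdist (z y : X) : R := Num.min (mdist z y) 1.

Lemma tdist_ge0 z y : 0 <= tdist z y.
Proof. by rewrite le_min mdist_ge0 ler01. Qed.

Lemma tdist_le1 z y : tdist z y <= 1.
Proof. by rewrite ge_min lexx orbT. Qed.

Lemma tdistxx z : tdist z z = 0.
Proof. by rewrite /tdist mdistxx; apply/min_idPl; exact: ler01. Qed.

Lemma tdist_eq0 z y : tdist z y = 0 -> z = y.
Proof.
rewrite /tdist; case: leP => _; first exact: mdist_positivity.
by move=> /eqP; rewrite oner_eq0.
Qed.

Lemma tdist_lt z y (r : R) : r <= 1 -> tdist z y < r -> mdist z y < r.
Proof. by move=> r1; rewrite gt_min => /orP[//|/lt_le_trans/(_ r1)]; rewrite ltxx. Qed.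

Lemma tdist_lip z x y : `|tdist z x - tdist z y| <= mdist x y.
Proof.
suff H a b : tdist z a - tdist z b <= mdist a b.
  by rewrite ler_norml lerNl opprB H metric_sym H.
rewrite lerBlDr /tdist; case: (leP (mdist z b) 1) => _.
  by rewrite ge_min addrC (metric_sym a) metric_triangle.
by rewrite ge_min; apply/orP; right; rewrite lerDr mdist_ge0.
Qed.

Lemma tdist_continuous z : continuous (tdist z).
Proof. exact/lip1_continuous/tdist_lip. Qed.

Lemma lift_tdist z : exists D : I -> G -> R, [/\
  forall i k, 0 <= D i k <= 1,
  forall i k k', `|D i k - D i k'| <= mdist k k' &
  close_along D (tdist z)].
Proof.
have [H HL Hf] := lift (tdist_lip z).
have tdist_clamp y : clamp 0 1 (tdist z y) = tdist z y.
  by rewrite clamp_id// tdist_ge0 tdist_le1.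
exists (fun i k => clamp 0 1 (H i k)); split.
- by move=> i k; rewrite clamp_ge clamp_le.
- by move=> i k k'; rewrite (le_trans (clamp_lip _ _ _)).
- move=> e /Hf; apply: filterS => p /=; rewrite -{2}tdist_clamp.
  exact/le_lt_trans/clamp_lip.
Qed.

(** A counterpart on the group of the truncated distance to [z]: smallness of [dlift z] at an
    element says that it represents a point near [z]. *)
Definition dlift z := sval (cid (lift_tdist z)).

Lemma dlift_ge0 z i k : 0 <= dlift z i k.
Proof. by rewrite /dlift; case: cid => D /= [/(_ i k)/andP[]]. Qed.

Lemma dlift_lip z i k k' : `|dlift z i k - dlift z i k'| <= mdist k k'.
Proof. by rewrite /dlift; case: cid => D /= []. Qed.

Lemma dlift_close z : close_along (dlift z) (tdist z).
Proof. by rewrite /dlift; case: cid => D /= []. Qed.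

Lemma dlift_ucb z : equi_ucb (dlift z).
Proof.
apply: (@equi_ucb_lip _ _ _ _ 1) => i k; last by move=> k'; exact: dlift_lip.
by rewrite /dlift; case: cid => D /= [/(_ i k)/andP[D0 D1] _ _]; rewrite ger0_norm.
Qed.

Lemma flim_dlift z x : flim (dlift z) x = tdist z x.
Proof.
by apply: flim_close; [exact: dlift_ucb|exact: tdist_continuous|exact: dlift_close].
Qed.

(* If [a] never vanished, finitely many balls [tdist y < a y / 3] would cover [X],
   so that [dlift y < 2 * a y / 3] for one of their centres [y]; this survives the
   translation by [g] and contradicts the definition of [a y] as a limit. *)
Lemma translate_point_ex (g : G) (x : X) :
  exists y, forall e : R, 0 < e -> F x [set p | dlift y (iota p) (g * phi p)%g < e].
Proof.
pose a y := flim (fun i k => dlift y i (g * k)%g) x.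
have aP y (e : R) : 0 < e -> F x [set p | `|dlift y (iota p) (g * phi p)%g - a y| < e].
  exact/flim_near/(equi_ucb_translate d_right_invariant)/dlift_ucb.
have [[y ay]|a_gt0] := pselect (exists y, a y <= 0).
  exists y => e e0; apply: filterS (aP y _ e0) => p /=.
  by rewrite ltr_norml => /andP[_]; lra.
have {}a_gt0 y : 0 < a y by rewrite ltNge; apply/negP => ay; apply: a_gt0; exists y.
have oU y : open [set w | tdist y w < a y / 3].
  by apply: (@open_comp _ _ (tdist y) [set r | r < a y / 3]) => [w _|];
    [exact: tdist_continuous|exact: open_lt].
move: X_compact; rewrite compact_cover => /(_ _ setT _ (fun y _ => oU y))[|J _ JX].
  by move=> w _; exists w => //=; rewrite tdistxx divr_gt0.
(* With this [eta], [dlift y < 2/3 * a y] at [k] gives [dlift y < 5/6 * a y] at [g * phi p], whereas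
   [FJ] below forces it above [5/6 * a y]. *)
have [eta [etaJ eta0]] : exists eta : R, (\bigcap_(y in [set` J]) [set r | r < a y / 6]) eta /\ 0 < eta.
  apply: (@filter_ex _ (0 : R)^'+); apply: filterI; last exact: nbhs_right_gt.
  by apply: filter_bigI => y yJ; apply: nbhs_right_lt; rewrite divr_gt0.
pose S i := \bigcup_(y in [set` J]) [set k | dlift y i k < a y * (2 / 3)].
have oS i : open (S i).
  apply: bigcup_open => y _; apply: (@open_comp _ _ (dlift y i) [set r | r < a y * (2 / 3)]) => [w _|];
    [exact/equi_ucb_continuous/dlift_ucb|exact: open_lt].
have GS : GG [set p | S (iota p) (phi p)].
  have GJ : GG (\bigcap_(y in [set` J])
      [set p | `|dlift y (iota p) (phi p) - tdist y (psi p)| < a y / 3]).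
    by apply: filter_bigI => y yJ; apply: dlift_close; rewrite divr_gt0.
  apply: filterS GJ => p pJ; have [y yJ /= yp] := JX (psi p) Logic.I.
  exists y => //=; have := pJ y yJ => /=; rewrite ltr_norml => /andP[_]; lra.
have FJ : F x (\bigcap_(y in [set` J])
    [set p | `|dlift y (iota p) (g * phi p)%g - a y| < a y / 6]).
  by apply: filter_bigI => y yJ; apply: aP; rewrite divr_gt0.
have [p [/= [k [y yJ /= ky] kp] pJ]] :=
  filter_ex (filterI (sub_fibre_filter psi x (translate oS GS g eta0)) FJ).
have := pJ y yJ; have := etaJ y yJ; have := dlift_lip y (iota p) (g * phi p)%g k.
rewrite /= ltr_norml ler_norml => /andP[_ ?] ? /andP[? _]; lra.
Qed.

Definition limit_act g x := sval (cid (translate_point_ex g x)).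

Lemma limit_actP g x (e : R) : 0 < e ->
  F x [set p | dlift (limit_act g x) (iota p) (g * phi p)%g < e].
Proof. by rewrite /limit_act; case: cid => y /= yP /yP. Qed.

(** The bound [|H - c| < C * dlift y + e / 3] holds along [GG]: near [y] because [c] is the limit
    there, elsewhere because [dlift y] is bounded below. It is an open condition, so it survives
    translation by [g] up to a small error; along the fibre filter at [x], [dlift y] is small at
    [g * phi p], which leaves [H] close to [c]. *)
Lemma flim_translate H g x : equi_ucb H ->
  flim (fun i k => H i (g * k)%g) x = flim H (limit_act g x).
Proof.
move=> Huc; set y := limit_act g x; set c := flim H y.
apply: flim_unique; first exact: equi_ucb_translate.
move=> e e0; have e30 : 0 < e / 3 by rewrite divr_gt0.
have [[M HM] /(_ _ e30)[d d0 Hd]] := Huc.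
have [U /nbhs_mdist_ex[r r0 rU] HU] := flim_near y Huc e30.
pose r' := Num.min r 1; have r'0 : 0 < r' by rewrite lt_min r0 ltr01.
pose C := 2 * (`|M| + `|c|) / r'.
have C0 : 0 <= C by rewrite divr_ge0 ?(ltW r'0)// mulr_ge0// addr_ge0.
(* [C] is chosen so that [C * dlift y] dominates [`|H - c|] away from [y]. *)
pose S i := [set k | `|H i k - c| - C * dlift y i k < e / 3].
have oS i : open (S i).
  apply: (@open_comp _ _ (fun k => `|H i k - c| - C * dlift y i k) [set s | s < e / 3]);
    last exact: open_lt.
  move=> k _; apply: cvgB; last first.
    by apply: cvgMr; exact/equi_ucb_continuous/dlift_ucb.
  apply: cvg_norm; apply: cvgB; last exact: cvg_cst.
  exact: equi_ucb_continuous.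
have GS : GG [set p | S (iota p) (phi p)].
  have r'20 : 0 < r' / 2 by rewrite divr_gt0.
  apply: filterS2 HU (dlift_close y r'20) => p /= pU.
  rewrite ltr_norml /S => /andP[yp _]; have [yr|yr] := ltP (tdist y (psi p)) r'.
    have /pU : U (psi p).
      apply/rU/(lt_le_trans (tdist_lt _ yr)); by rewrite ge_min lexx ?orbT.
    have := mulr_ge0 C0 (dlift_ge0 y (iota p) (phi p)).
    by rewrite /c /=; lra.
  have Cd : `|M| + `|c| <= C * dlift y (iota p) (phi p).
    have -> : `|M| + `|c| = C * (r' / 2) by rewrite /C; field; rewrite gt_eqF.
    by rewrite ler_wpM2l//; lra.
  have := ler_normB (H (iota p) (phi p)) c; have := HM (iota p) (phi p).
  by have := ler_norm M; rewrite /=; lra.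
(* Both [dlift y] at [g * phi p] and the distance from there to [k] are below [s], so [C * dlift y]
   at [k] is at most [2 * C * s <= e / 3]. *)
pose s := e / (6 * (C + 1)); have s0 : 0 < s by rewrite divr_gt0// mulr_gt0// ltr_wpDl.
have Cs : C * s <= e / 6.
  rewrite /s mulrA ler_pdivrMr ?mulr_gt0// ?ltr_wpDl//; lra.
have eta0 : 0 < Num.min d s by rewrite lt_min d0.
apply: filterS2 (sub_fibre_filter psi x (translate oS GS g eta0)) (limit_actP g x s0).
move=> p /= [k Sk]; rewrite lt_min => /andP[/(Hd (iota p)) kd ks] yp.
have yk := dlift_lip y (iota p) (g * phi p)%g k.
have Dk : C * dlift y (iota p) k <= C * s + C * s.
  rewrite -mulrDr ler_wpM2l//; rewrite ler_norml in yk; move: yk => /andP[yk _].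
  by rewrite -/y in yp; lra.
have := ler_distD (H (iota p) k) (H (iota p) (g * phi p)%g) c.
by move: Sk; rewrite /S/=; lra.
Qed.

Lemma flim_dist_le H H' x (c : R) : equi_ucb H -> equi_ucb H' ->
  (forall i k, `|H i k - H' i k| <= c) -> `|flim H x - flim H' x| <= c.
Proof.
move=> Huc Huc' HH'; apply/ler_addgt0Pr => e e0; have e20 : 0 < e / 2 by rewrite divr_gt0.
have [p [/= Hp Hp']] := filter_ex (filterI (flim_near x Huc e20) (flim_near x Huc' e20)).
move: Hp Hp' (HH' (iota p) (phi p)); rewrite !ltr_norml !ler_norml.
by move=> /andP[? ?] /andP[? ?] /andP[? ?]; apply/andP; split; lra.
Qed.

(** Through [tdist_eq0], this reduces the action laws to identities between families of functions on
    [G]. *)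
Lemma tdist_limit_act z g x :
  tdist z (limit_act g x) = flim (fun i k => dlift z i (g * k)%g) x.
Proof. by rewrite flim_translate ?flim_dlift//; exact: dlift_ucb. Qed.

Lemma limit_act1 x : limit_act 1%g x = x.
Proof.
apply/esym/tdist_eq0; rewrite tdist_limit_act -(tdistxx x) -flim_dlift.
by congr flim; apply/funext => i; apply/funext => k; rewrite mul1g.
Qed.

Lemma limit_actM g h x : limit_act (g * h)%g x = limit_act g (limit_act h x).
Proof.
apply/esym/tdist_eq0; set z := limit_act g _.
rewrite tdist_limit_act -(tdistxx z) {3}/z tdist_limit_act -flim_translate.
  by congr flim; apply/funext => i; apply/funext => k; rewrite mulgA.
exact/(equi_ucb_translate d_right_invariant)/dlift_ucb.
Qed.

(** Replacing [g] by [h] changes [dlift z i (g * k)] by at most [mdist g h], uniformly in [k] by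
    right invariance; replacing [x] by [y] with [g] fixed is controlled by continuity of [flim]. *)
Lemma limit_act_continuous : continuous (fun gx : G * X => limit_act gx.1 gx.2).
Proof.
move=> [g x] /=; set z := limit_act g x.
have uc h : equi_ucb (fun i k => dlift z i (h * k)%g).
  exact/(equi_ucb_translate d_right_invariant)/dlift_ucb.
apply/metricType_numDomainType.cvgrPdist_lt => /= e e0.
pose e' := Num.min e 1; have e'0 : 0 < e' by rewrite lt_min e0 ltr01.
have e'20 : 0 < e' / 2 by rewrite divr_gt0.
exists ([set h | mdist g h < e' / 2],
        [set y | `|flim (fun i k => dlift z i (g * k)%g) x
                 - flim (fun i k => dlift z i (g * k)%g) y| < e' / 2]).
  split; first by apply/nbhs_mdist_ex; exists (e' / 2).
  by have /cvgrPdist_lt := flim_continuous (uc g) (x := x); exact.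
move=> [h y] /= [gh xy]; apply: lt_le_trans (_ : e' <= e); last by rewrite ge_min lexx.
apply: tdist_lt; first by rewrite ge_min lexx orbT.
rewrite tdist_limit_act; move: xy; rewrite -tdist_limit_act -/z tdistxx.
have := @flim_dist_le _ _ y (mdist g h) (uc g) (uc h).
rewrite ltr_norml ler_norml => /(_ _)/andP-[|? _ /andP[? _]]; last by lra.
by move=> i k; rewrite (le_trans (dlift_lip _ _ _ _))// d_right_invariant.
Qed.

Lemma limit_act_flow : is_flow limit_act.
Proof.
split=> //.
- by exists point.
- exact: metric_hausdorff.
- by split; [exact: limit_act1|exact: limit_actM].
- exact: limit_act_continuous.
Qed.

(** Take a cluster point of the orbit map along the fibre filter. The values of each [h] converge
    along that filter, so their limit must be the value of [h] at the cluster point. *)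
Lemma flow_limit_ex (Y : topologicalType) (actY : G -> Y -> Y) (y0 : Y) (x : X) :
  is_flow actY -> exists y, forall h : Y -> R, continuous h ->
    h y = flim (fun _ k => h (actY k y0)) x.
Proof.
move=> fY; have [_ cY _ _ _] := fY.
have [|y [_ cly]] := cY ((fun p => actY (phi p) y0) @ F x) _; first exact: filterT.
exists y => h ch; apply/eqP; rewrite -subr_eq0 -normr_le0; apply/ler_addgt0Pr => e e0.
have e20 : 0 < e / 2 by rewrite divr_gt0.
have Huc := orbit_equi_ucb (I := I) d_right_invariant y0 fY ch.
have /cvgrPdist_lt/(_ _ e20) hy := ch y.
have [|z [/= hz]] := cly [set z | `|h z - flim (fun _ k => h (actY k y0)) x| < e / 2] _ _ hy.
  exact: flim_near.
rewrite !ltr_norml => /andP[? ?]; move: hz; rewrite ltr_norml => /andP[? ?].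
by rewrite add0r ler_norml; apply/andP; split; lra.
Qed.

Lemma limit_act_universal (Y : topologicalType) (actY : G -> Y -> Y) :
  is_flow actY -> exists f : X -> Y, is_flow_morphism limit_act actY f.
Proof.
move=> fY; have [[y0 _] cY hY [_ actM] cact] := fY.
pose f x := sval (cid (flow_limit_ex y0 x fY)).
have fP x h : continuous h -> h (f x) = flim (fun _ k => h (actY k y0)) x.
  by move=> ch; rewrite /f; case: cid => y /= ->.
exists f; split.
  apply: (continuous_functions_initial (R := R) cY hY) => h ch.
  have -> : h \o f = flim (fun _ k => h (actY k y0)).
    by apply/funext => x /=; rewrite fP.
  exact: (flim_continuous (orbit_equi_ucb d_right_invariant y0 fY ch)).
(* Equivariance is tested on continuous [h]: translating the family of [h] by [g] amounts to using
   the function [h (actY g _)]. *)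
move=> g x; apply: (continuous_functions_separate (R := R) cY hY) => h ch.
have chg : continuous (fun y => h (actY g y)).
  move=> y; apply: (continuous_comp _ (ch _)).
  apply: (@cvg_comp _ _ _ (fun y => (g, y)) (fun gy : G * Y => actY gy.1 gy.2) _ (nbhs (g, y))).
    move=> U [[A B] /= [gA yB] AB]; apply: filterS yB => z Bz.
    by apply: AB; split=> //=; exact: nbhs_singleton.
  exact: (cact (g, y)).
rewrite fP// -flim_translate; last exact: (orbit_equi_ucb d_right_invariant y0 fY ch).
rewrite (fP x _ chg); congr flim.
by apply/funext => i; apply/funext => k; rewrite actM.
Qed.

End concentration_limit.

(** * Parametrizations and convergence in measure *)

Lemma ultra_bounded_lim {R : realType} {T : Type} (U : set_system T)
    (u : T -> R) (M : R) : UltraFilter U -> (forall n, `|u n| <= M) ->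
  exists l : R, forall e : R, 0 < e -> U [set n | `|u n - l| < e].
Proof.
move=> UU uM; have UP : ProperFilter U by exact: ultra_proper.
have [|l [_ ul]] := @segment_compact R (- M) M (u @ U) (fmap_proper_filter u UP) _.
  by apply: (@filterE _ U) => n; rewrite /= in_itv/= -ler_norml.
exists l => e e0; have [//|Ul] := in_ultra_setVsetC [set n | `|u n - l| < e] UU.
have lU : (u @ U) [set r | ~ `|r - l| < e] := Ul.
have [r [/= rl]] := ul [set r | ~ `|r - l| < e] (ball l e) lU (nbhsx_ballx l e e0).
by rewrite /ball/= distrC.
Qed.

Section measure_layer.
Context {R : realType}.

Lemma measurable_I01 : measurable (I01 : set R).
Proof. exact: measurable_itv. Qed.

Lemma lebesgue_measure_I01 : lebesgue_measure (I01 : set R) = 1%E.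
Proof. by rewrite /I01 lebesgue_measure_itv/= lte01 oppr0 adde0. Qed.

Lemma measurable_continuous_parametrization (X : mmSpace R) (phi : R -> X) (F : X -> R) :
  continuous F -> parametrization X phi -> measurable_fun I01 (F \o phi).
Proof.
move=> cF [mphi _]; apply: (measurability _ (RGenOpens.measurableE R)).
move=> _ [_ [x [y ->]] <-].
have := mphi measurable_I01 (F @^-1` `]x, y[%classic); apply.
by apply: sub_sigma_algebra; apply: open_comp => // z _; exact: cF.
Qed.

(** Outer measure at most [e], expressed by a measurable cover so that [B] itself may be
    arbitrary. *)
Definition small (e : R) (B : set R) : Prop :=
  exists2 M, measurable M & I01 `&` B `<=` M /\ (lebesgue_measure M <= e%:E)%E.

Lemma small_sub (e e' : R) (B B' : set R) :
  e <= e' -> B' `<=` B -> small e B -> small e' B'.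
Proof.
move=> ee' BB' [M mM [BM Me]]; exists M => //; split.
  by move=> t [t01 /BB' Bt]; exact: BM.
by rewrite (le_trans Me)// lee_fin.
Qed.

Lemma me_lt_small (f g : R -> R) (e : R) :
  measurable_fun I01 f -> measurable_fun I01 g -> me f g < e ->
  small e [set t | ~ `|f t - g t| < e].
Proof.
move=> mf mg.
have mfg r : measurable (I01 `&` [set t | r < `|f t - g t|]).
  rewrite -preimage_itvoy.
  have mn : measurable_fun I01 (fun t => `|f t - g t|).
    by apply: measurableT_comp => //; exact: measurable_funB.
  exact: (mn measurable_I01).
rewrite /me => /inf_lt[].
  exists 1; split; first exact: ltr01.
  rewrite -lebesgue_measure_I01; apply: le_measure.
  - by apply: mem_set; exact: mfg.
  - by apply: mem_set; exact: measurable_I01.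
  - exact: subIsetl.
move=> r [r0 fgr] re; exists (I01 `&` [set t | r < `|f t - g t|]) => //; split.
  move=> t [t01] /= /negP; rewrite -leNgt => et; split=> //.
  exact: lt_le_trans et.
by rewrite (le_trans fgr)// lee_fin ltW.
Qed.

Section product_filter.
Context (U : set_system nat) {FU : ProperFilter U}.

Definition in_measure_filter : set_system (nat * R) :=
  [set S | forall e : R, 0 < e -> U [set n | small e [set t | ~ S (n, t)]]].

#[global] Instance in_measure_filter_filter : Filter in_measure_filter.
Proof.
split.
- move=> e e0; apply: filterS filterT => n _; exists set0 => //.
  by split; [move=> t [_ /= []]|rewrite measure0 lee_fin ltW].
- move=> S S' US US' e e0; have e20 : 0 < e / 2 by rewrite divr_gt0.
  apply: filterS2 (US _ e20) (US' _ e20) => n [M mM [SM Me]] [M' mM' [SM' Me']].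
  exists (M `|` M'); first exact: measurableU.
  split.
    move=> t [t01 /= /not_andP[St|St]]; [left; exact: SM|right; exact: SM'].
  rewrite (le_trans (measureU2 _ _ _))//.
  by rewrite (splitr e) EFinD leeD.
- move=> S S' SS' US e e0; apply: filterS (US _ e0) => n.
  by apply: small_sub => // t /= nS' /SS'.
Qed.

Lemma in_measure_filterP (S : set (nat * R)) (d : nat -> R) :
  (forall e : R, 0 < e -> U [set n | d n < e]) ->
  (U [set n | small (d n) [set t | ~ S (n, t)]]) -> in_measure_filter S.
Proof.
move=> d0 US e e0; apply: filterS2 (d0 _ e0) US => n /= dn.
by apply: small_sub => //; exact: ltW.
Qed.

End product_filter.
End measure_layer.

Section subgroup_embedding.
Context {R : realType} {G : metricGroupType R} (K : compactSubgroup G).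

Definition cs_val (k : K) : G := val k.

Lemma cs_valM (k k' : K) : cs_val (k * k')%g = (cs_val k * cs_val k')%g.
Proof. by []. Qed.

Lemma cs_val_continuous : continuous cs_val.
Proof.
move=> k S /nbhs_mdist_ex[e e0 eS].
by apply/nbhs_mdist_ex; exists e => // k'; exact: eS.
Qed.

End subgroup_embedding.

(** * Descent, lifting and translation from concentration and Haar invariance *)

Section concentrating_parametrizations.
Context {R : realType} {G : metricGroupType R}.
Context (K : nat -> compactSubgroup G) (mu : forall n, probability (borel (K n)) R).
Context (mu_haar : forall n, is_normalized_haar (mu n)).
Context (X : mmSpace R) (X_compact : compact [set: X]).
Context (X_fully_supported : fully_supported X).
Context (K_dense : forall (g : G) (e : R), 0 < e ->
  exists2 g', mdist g g' < e & \forall n \near \oo, cs_set (K n) g').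
Context (delta : nat -> R).
Context (delta0 : forall e : R, 0 < e -> \forall n \near \oo, delta n < e).
Context (phi : forall n, R -> K n) (psi : nat -> R -> X).
Context (phi_param : forall n, parametrization (subgroup_mmSpace (mu n)) (phi n)).
Context (psi_param : forall n, parametrization X (psi n)).
Context (delta_descend : forall n (F : K n -> R), Lip1 (subgroup_mmSpace (mu n)) F ->
  exists2 f, Lip1 X f & me (F \o phi n) (f \o psi n) < delta n).
Context (delta_lift : forall n (f : X -> R), Lip1 X f ->
  exists2 F, Lip1 (subgroup_mmSpace (mu n)) F & me (f \o psi n) (F \o phi n) < delta n).
Context (U : set_system nat) (UU : UltraFilter U) (U_infty : \oo `<=` U).
Context (d_right_invariant :
  forall g x y : G, mdist (x * g)%g (y * g)%g = mdist x y).

Local Notation GG := (in_measure_filter (R := R) U).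
Local Notation Phi := (fun p : nat * R => cs_val (phi p.1 p.2)).
Local Notation Psi := (fun p : nat * R => psi p.1 p.2).

#[local] Instance U_proper : ProperFilter U := @ultra_proper _ U UU.

(** By full support an open neighborhood of [x] has positive measure, and its preimages under all
    [psi n] have the same one; they do not fit in a set of half that measure. *)
Lemma in_measure_full (x : X) (V : set X) : nbhs x V -> ~ GG [set p | ~ V (Psi p)].
Proof.
rewrite nbhsE => -[W [oW Wx] WV] GV.
have mW : measurable (W : set (borel X)) by exact: sub_sigma_algebra.
have : spt X x by rewrite X_fully_supported.
move=> /(_ W oW Wx) W0.
have Wfin : mm_measure X W \is a fin_num.
  rewrite ge0_fin_numE ?measure_ge0//.
  by rewrite (le_lt_trans (probability_le1 _ mW))// ltey.
have w0 : 0 < fine (mm_measure X W) by rewrite fine_gt0// W0 ltey_eq Wfin.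
have w20 : 0 < fine (mm_measure X W) / 2 by rewrite divr_gt0.
have [n [M mM [VM Me]]] := filter_ex (GV _ w20).
have [mpsi psiW] := psi_param n.
have : (lebesgue_measure (I01 `&` psi n @^-1` W) <= (fine (mm_measure X W) / 2)%:E)%E.
  apply: le_trans Me; apply: le_measure.
  - by apply: mem_set; exact: (mpsi measurable_I01).
  - exact: mem_set.
  - by move=> t [t01 Wt]; apply: VM; split=> //= nVt; apply: nVt; exact: WV.
by rewrite (psiW _ mW) -{1}(fineK Wfin) lee_fin; lra.
Qed.

Lemma in_measure_descend (H : nat -> G -> R) :
  (exists M : R, forall i k, `|H i k| <= M) ->
  (forall i k k', `|H i k - H i k'| <= mdist k k') ->
  exists2 f : X -> R, (forall x y, `|f x - f y| <= mdist x y) &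
    close_along GG fst Phi Psi H f.
Proof.
move=> [M HM] HL.
have /(_ _)/cid2-/all_sig2[f fL Hf] n := @delta_descend n (H n \o @cs_val _ _ (K n)) (fun k k' => HL n _ _).
(* The ultralimit needs bounded values. Clamping does not increase the distance to [H n], whose
   values already lie in [[-M, M]]. *)
pose f' n x := clamp (- M) M (f n x).
have M0 : 0 <= M by exact: le_trans (HM 0 1%g).
have f'M n x : `|f' n x| <= M.
  by rewrite ler_norml clamp_ge ?clamp_le//; lra.
have f'L n x y : `|f' n x - f' n y| <= mdist x y.
  by rewrite (le_trans (clamp_lip _ _ _))// ?fL//; lra.
have /(_ _)/cid-/all_sig[g gP] x := ultra_bounded_lim UU (f'M^~ x).
have gL x y : `|g x - g y| <= mdist x y.
  apply/ler_addgt0Pr => e e0; have e20 : 0 < e / 2 by rewrite divr_gt0.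
  have [n [/=]] := filter_ex (filterI (gP x _ e20) (gP y _ e20)).
  have := f'L n x y; rewrite !ltr_norml !ler_norml.
  by move=> /andP[? ?] /andP[? ?] /andP[? ?]; apply/andP; split; lra.
(* Pointwise convergence of 1-Lipschitz functions on a compact space is uniform. *)
have unif e : 0 < e -> U [set n | forall x, `|f' n x - g x| < e].
  move=> e0; have e30 : 0 < e / 3 by rewrite divr_gt0.
  have : \forall n \near U, [set: X] `<=` (fun x => `|f' n x - g x| < e).
    apply: ((compact_near_coveringP _).1 X_compact) => x _.
    exists ([set y | mdist x y < e / 3], [set n | `|f' n x - g x| < e / 3]).
      by split=> /=; [apply/nbhs_mdist_ex; exists (e / 3)|exact: gP].
    move=> [y n] /= [xy]; have := f'L n x y; have := gL x y; rewrite !ltr_norml !ler_norml.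
    by move=> /andP[? ?] /andP[? ?] /andP[? ?]; apply/andP; split; lra.
  by apply: filterS => n Un x; exact: Un.
exists g => // e e0; have e20 : 0 < e / 2 by rewrite divr_gt0.
apply: (in_measure_filterP (d := delta)) => [r r0|]; first exact/U_infty/delta0.
apply: filterS2 (U_infty (delta0 e20)) (unif _ e20) => n /= dn f'g.
have mHf : measurable_fun I01 ((H n \o @cs_val _ _ (K n)) \o phi n).
  apply: (measurable_continuous_parametrization _ (phi_param n)).
  by apply: lip1_continuous => k k'; exact: HL.
have mf : measurable_fun I01 (f n \o psi n).
  exact: (measurable_continuous_parametrization (lip1_continuous (fL n)) (psi_param n)).
apply: small_sub (me_lt_small mHf mf (Hf n)) => //.
move=> t /= Ht Hft; apply: Ht.
have HM' : - M <= H n (cs_val (phi n t)) <= M by rewrite -ler_norml.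
have MM : - M <= M by lra.
have ff' := clamp_lip (H n (cs_val (phi n t))) (f n (psi n t)) MM.
rewrite (clamp_id HM') in ff'.
have := le_lt_trans ff' Hft; have := f'g (psi n t).
rewrite !ltr_norml /f' => /andP[? ?] /andP[? ?].
by apply/andP; split; lra.
Qed.

(** Concentration gives a lift on each [K n] only; its McShane extension is 1-Lipschitz on [G] and
    agrees with it at the values of [phi n]. *)
Lemma in_measure_lift (f : X -> R) : (forall x y, `|f x - f y| <= mdist x y) ->
  exists2 H : nat -> G -> R, (forall i k k', `|H i k - H i k'| <= mdist k k') &
    close_along GG fst Phi Psi H f.
Proof.
move=> fL; have /(_ _)/cid2-/all_sig2[h hL fh] n := @delta_lift n f fL.
have hL1 n (k k' : K n) : `|h n k - h n k'| <= 1 * mdist (cs_val k) (cs_val k').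
  by rewrite mul1r; exact: hL.
pose H n := inf_conv (@cs_val _ _ (K n)) 1 (h n).
have HE n k : H n (cs_val k) = h n k by have [_] := inf_conv_id ler01 (@hL1 n); exact.
exists H.
  move=> n k k'; rewrite -(mul1r (mdist k k')); apply: inf_conv_lip => //.
    by exists 1%g.
  by have [] := inf_conv_id ler01 (@hL1 n).
move=> e e0; apply: (in_measure_filterP (d := delta)) => [r r0|]; first exact/U_infty/delta0.
apply: filterS (U_infty (delta0 e0)) => n /= dn.
have mf : measurable_fun I01 (f \o psi n).
  exact: (measurable_continuous_parametrization (lip1_continuous fL) (psi_param n)).
have mh : measurable_fun I01 (h n \o phi n).
  exact: (measurable_continuous_parametrization (lip1_continuous (hL n)) (phi_param n)).
apply: small_sub (me_lt_small mf mh (fh n)) => // t /= Ht Hft; apply: Ht.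
by rewrite HE distrC; exact: lt_trans Hft dn.
Qed.

(* Invariance of the Haar measure under [g'] in [K n], where [g'] approximates [g]. *)
Lemma in_measure_translate (S : nat -> set G) : (forall i, open (S i)) ->
  GG [set p | S p.1 (Phi p)] -> forall g (eta : R), 0 < eta ->
  GG [set p | exists2 k, S p.1 k & mdist (g * Phi p)%g k < eta].
Proof.
move=> oS GS g eta eta0 e e0; have [g' gg' Kg'] := K_dense g eta0.
apply: filterS2 (U_infty Kg') (GS e e0) => n /= Kng' [M mM [SM Me]].
pose g1 : K n := exist _ g' (mem_set Kng').
pose B := [set k : K n | ~ S n (cs_val k)].
pose A := [set k : K n | ~ S n (g' * cs_val k)%g].
have closed_borel (C : set (K n)) : open (~` C) -> measurable (C : set (borel (K n))).
  by move=> oC; rewrite -[C]setCK; apply: measurableC; exact: sub_sigma_algebra.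
have mB : measurable (B : set (borel (K n))).
  apply: closed_borel; rewrite /B (_ : ~` _ = @cs_val _ _ (K n) @^-1` S n).
    by apply: open_comp => // k _; exact: cs_val_continuous.
  by apply/seteqP; split=> k /=; [exact: contrapT|move=> ?; exact].
have mA : measurable (A : set (borel (K n))).
  apply: closed_borel.
  rewrite /A (_ : ~` _ = (fun k : K n => (g' * cs_val k)%g) @^-1` S n).
    apply: open_comp => // k _; apply: (@continuous_mulg _ _ _ (fun=> g')).
      exact: cst_continuous.
    exact: cs_val_continuous.
  by apply/seteqP; split=> k /=; [exact: contrapT|move=> ?; exact].
(* Translation by [g1] carries [A] onto [B], so both have the same Haar measure, and their preimages
   under [phi n] the same Lebesgue measure. *)
have g1A : [set (g1 * k)%g | k in A] = B.
  apply/seteqP; split=> [_ [k Ak <-]//|k Bk].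
  exists (g1^-1 * k)%g; last by rewrite mulVKg.
  by move=> /=; rewrite -[g']/(cs_val g1) -cs_valM mulVKg.
have [mphi phiE] := phi_param n.
exists (I01 `&` phi n @^-1` A); first exact: (mphi measurable_I01).
split.
  (* Outside [A] the element [g' * phi n t] is the required [k]: by right invariance its distance to
     [g * phi n t] is [mdist g g']. *)
  move=> t [t01 nt]; split=> // St; apply: nt; exists (g' * cs_val (phi n t))%g => //.
  by rewrite d_right_invariant.
rewrite (phiE _ mA) /= -(mu_haar g1 mA) g1A -[mu n B]/(mm_measure (subgroup_mmSpace (mu n)) B).
rewrite -(phiE _ mB) (le_trans _ Me)//; apply: le_measure.
- by apply: mem_set; exact: (mphi measurable_I01).
- exact: mem_set.
- by move=> t [t01 Bt]; apply: SM.
Qed.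

Lemma concentrating_parametrizations_flow : exists actX : G -> X -> X,
  is_flow actX /\ forall (Y : topologicalType) (actY : G -> Y -> Y), is_flow actY ->
    exists f : X -> Y, is_flow_morphism actX actY f.
Proof.
exists (limit_act in_measure_full in_measure_descend d_right_invariant X_compact
  in_measure_lift in_measure_translate).
split; first exact: limit_act_flow.
by move=> Y actY; exact: limit_act_universal.
Qed.

End concentrating_parametrizations.

(** * Near-optimal parametrizations and conclusion *)

Lemma open_mdist_lt {R : realFieldType} {T : metricType R} (x : T) (e : R) :
  open [set y | mdist x y < e].
Proof.
rewrite openE => y /= xy; apply/nbhs_mdist_ex.
exists (e - mdist x y); first by rewrite subr_gt0.
move=> z yz /=; rewrite (le_lt_trans (metric_triangle _ y _))//.
by rewrite -ltrBrDl.
Qed.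

Lemma dconc_lt {R : realType} (Y X : mmSpace R) (c : R) : (dconc Y X < c%:E)%E ->
  exists (phi : R -> Y) (psi : R -> X),
    [/\ parametrization Y phi, parametrization X psi,
      (forall F, Lip1 Y F -> exists2 f, Lip1 X f & me (F \o phi) (f \o psi) < c) &
      (forall f, Lip1 X f -> exists2 F, Lip1 Y F & me (f \o psi) (F \o phi) < c)].
Proof.
move=> /ereal_inf_lt[_ [phi [psi [pphi ppsi ->]]]].
move=> /ereal_inf_lt[_ [e [e0 eB eA] <-]]; rewrite lte_fin => ec.
exists phi, psi; split=> // [F LF|f Lf].
- have [|_ [f Lf <-] Ff] := eA (F \o phi); first by exists F.
  by exists f => //; exact: lt_trans ec.
- have [|_ [F LF <-] fF] := eB (f \o psi); first by exists f.
  by exists F => //; exact: lt_trans ec.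
Qed.

Unset Implicit Arguments.
Set Strict Implicit.
Set Printing Implicit Defensive.

Theorem mainTheorem4 (R : realType) (G : metricGroupType R)
    (d_right_invariant :
      forall g x y : G, mdist (x * g)%g (y * g)%g = mdist x y)
    (K : nat -> compactSubgroup G)
    (K_increasing :
      forall m n : nat, (m <= n)%N -> cs_set (K m) `<=` cs_set (K n))
    (K_dense : dense (\bigcup_n cs_set (K n)))
    (mu : forall n, probability (borel (K n)) R)
    (mu_haar : forall n, is_normalized_haar (mu n))
    (X : mmSpace R)
    (X_fully_supported : fully_supported X)
    (X_compact : compact [set: X])
    (K_concentrates : concentrates (fun n => subgroup_mmSpace (mu n)) X) :
  exists actX : G -> X -> X,
    is_flow actX /\
    forall (Y : topologicalType) (actY : G -> Y -> Y), is_flow actY ->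
      exists f : X -> Y, is_flow_morphism actX actY f.
Proof.
(* Choose indices [s j >= j] at which the observable distance is below [1 / (j + 1)]; this bound
   serves as [delta j]. *)
have sub j : exists2 n, (j <= n)%N &
    (dconc (subgroup_mmSpace (mu n)) X < (j.+1%:R^-1)%:E)%E.
  have j0 : (0 < (j.+1%:R^-1 : R)%:E)%E by rewrite lte_fin invr_gt0 ltr0n.
  have near_lt : \forall n \near \oo,
      (dconc (subgroup_mmSpace (mu n)) X < (j.+1%:R^-1)%:E)%E.
    exact: K_concentrates (open_ereal_lt' j0).
  by have [n [jn ?]] := filter_ex (filterI (nbhs_infty_ge j) near_lt); exists n.
have /(_ _)/cid2-/all_sig2[s s_ge s_lt] j := sub j.
have /(_ _)/cid/= pp j := dconc_lt (s_lt j).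
pose phi j := sval (pp j).
have phiP j : exists psi : R -> X, _ := svalP (pp j).
pose psi j := sval (cid (phiP j)).
have psiP j := svalP (cid (phiP j)).
have [U [UU U_infty]] := ultraFilterLemma (eventually_filter : ProperFilter \oo).
apply: (@concentrating_parametrizations_flow R G (fun j => K (s j)) (fun j => mu (s j))
  (fun j => mu_haar (s j)) X X_compact X_fully_supported _ (fun j => j.+1%:R^-1) _ phi psi
  _ _ _ _ U UU U_infty d_right_invariant).
(* A nearby [g'] lies in some [K m], hence in [K (s j)] for all [j >= m], since [s j >= j] and the
   subgroups increase. *)
- move=> g e e0.
  have [g' [gg' [m _ Kg']]] : ([set h | mdist g h < e] `&` \bigcup_n cs_set (K n)) !=set0.
    apply: K_dense; first by exists g; rewrite /= mdistxx.
    exact: open_mdist_lt.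
  exists g' => //; exists m => // j /= mj; apply: K_increasing Kg'.
  exact: leq_trans (s_ge j).
- by move=> e e0; exact: (near_infty_natSinv_lt (PosNum e0)).
- by move=> j; have [] := psiP j.
- by move=> j; have [] := psiP j.
- by move=> j; have [] := psiP j.
- by move=> j; have [] := psiP j.
Qed.
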